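(* Let $r\in R$ be a retailer, let $b,b'\in\{0,1,2\}$ be levels with $b<b'$, and let $l\in\{2,\ldots,|T|\}$. Let $L^b=\{1,\ldots,l_b\}$ with $1\le l_b<l$, and $S^b\subseteq L^b$. Let $L^{b'}=\{l_b+1,\ldots,l\}$ and $S^{b'}\subseteq L^{b'}$. Then the two-level inequality $$\sum_{k\in L^b\setminus S^b}x^{br}_k+\sum_{k\in S^b}d^r_{kl}\,y^{\delta^b_w(r)}_k+\sum_{k\in L^{b'}\setminus S^{b'}}x^{b'r}_k+\sum_{k\in S^{b'}}d^r_{kl}\,y^{\delta^{b'}_w(r)}_k\ \ge\ d^r_{1l}$$ is valid for $X^{3LF}$, i.e. it is satisfied by every element of $X^{3LF}$.
   Context: Problem data (uncapacitated three-level lot-sizing and replenishment problem with a distribution structure). $T=\{1,\ldots,|T|\}$ is a finite set of consecutive periods. $F=P\cup W\cup R$ is a finite set of facilities (disjoint union), with $P=\{p\}$ (plant, level 0), $W$ the warehouses (level 1), $R$ the retailers (level 2). Each retailer $r\in R$ has a unique warehouse $\delta_w(r)\in W$. Write $\delta^0_w(r)=p$, $\delta^1_w(r)=\delta_w(r)$, $\delta^2_w(r)=r$. Each retailer $r$ has demands $d^r_t\ge 0$, $t\in T$, and $d^r_{kt}=\sum_{l=k}^{t}d^r_l$ for $1\le k\le t\le |T|$. $X^{3LF}$ is the set of all $(x^0,x^1,x^2,s^0,s^1,s^2,y)$, with $x^b=(x^{br}_t)$, $s^b=(s^{br}_t)$ indexed by $r\in R$, $t\in T$ ($b\in\{0,1,2\}$),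 and $y=(y^i_t)$ indexed by $i\in F$, $t\in T$, with the convention $s^{br}_0=0$, satisfying for all $r\in R$, $t\in T$: - $s^{0r}_{t-1}+x^{0r}_t=x^{1r}_t+s^{0r}_t$; - $s^{1r}_{t-1}+x^{1r}_t=x^{2r}_t+s^{1r}_t$; - $s^{2r}_{t-1}+x^{2r}_t=d^r_t+s^{2r}_t$; - $x^{0r}_t\le d^r_{t|T|}y^p_t$, $\ x^{1r}_t\le d^r_{t|T|}y^{\delta_w(r)}_t$, $\ x^{2r}_t\le d^r_{t|T|}y^r_t$; - $x^{0r}_t,x^{1r}_t,x^{2r}_t,s^{0r}_t,s^{1r}_t,s^{2r}_t\ge 0$; and $y^i_t\in\{0,1\}$ for all $i\in F$, $t\in T$. *)

(* Defs.v *)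
From mathcomp Require Import all_boot all_order all_algebra.

Set Implicit Arguments.
Unset Strict Implicit.
Unset Printing Implicit Defensive.

Import Order.TTheory GRing.Theory Num.Theory.
Local Open Scope ring_scope.

(* The periods 1, ..., n are the ordinals of 'I_n: the ordinal k, whose value
   lies in 0, ..., n - 1, stands for the period numbered k + 1. *)
Definition period_number (n : nat) (k : 'I_n) : nat := k.+1.

Definition periods (n i j : nat) : {set 'I_n} :=
  [set k : 'I_n | (i <= period_number k <= j)%N].
Arguments periods : clear implicits.

(* K generalizes the field of real numbers. *)
Record lot_sizing_data (K : realFieldType) := LotSizingData {
  horizon : nat;
  warehouse : finType;
  retailer : finType;
  warehouse_of : retailer -> warehouse;
  demand : retailer -> 'I_horizon -> K;
  demand_ge0 : forall r t, 0 <= demand r t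
}.

Section Model.
Variables (K : realFieldType) (D : lot_sizing_data K).

Local Notation T := 'I_(horizon D).
Local Notation Ret := (retailer D).

(* The disjoint union of the one-element set of plants, the warehouses and the
   retailers. *)
Definition facility : finType := (unit + warehouse D + Ret)%type.
Definition plant : facility := inl (inl tt).
Definition warehouse_facility (w : warehouse D) : facility := inl (inr w).
Definition retailer_facility (r : Ret) : facility := inr r.

Definition level0 : 'I_3 := @Ordinal 3 0 isT.
Definition level1 : 'I_3 := @Ordinal 3 1 isT.
Definition level2 : 'I_3 := @Ordinal 3 2 isT.

(* supplier b r is delta^b_w(r); for b = 2 it is the retailer r itself. *)
Definition supplier (b : 'I_3) (r : Ret) : facility :=
  match val b with
  | 0%N => plant
  | 1%N => warehouse_facility (warehouse_of r)
  | _ => retailer_facility r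
  end.

(* The total demand of r over the periods numbered i, ..., j. *)
Definition cum_demand (r : Ret) (i j : nat) : K :=
  \sum_(t in periods (horizon D) i j) demand r t.

(* px v b r t is x^{br}_t, ps v b r t is s^{br}_t and py v i t is y^i_t. *)
Record point := Point {
  px : 'I_3 -> Ret -> T -> K;
  ps : 'I_3 -> Ret -> T -> K;
  py : facility -> T -> K
}.

(* The value at period t - 1, with the convention that it is 0 at period 0.
   The cyclic predecessor ord_pred does not wrap around in the else branch. *)
Definition previous (s : T -> K) (t : T) : K :=
  if period_number t == 1%N then 0 else s (ord_pred t).

Definition X3LF (v : point) : Prop :=
  let x := px v in let s := ps v in let y := py v in
  (forall (r : Ret) (t : T),
    [/\ previous (s level0 r) t + x level0 r t = x level1 r t + s level0 r t,
        previous (s level1 r) t + x level1 r t = x level2 r t + s level1 r t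
      & previous (s level2 r) t + x level2 r t = demand r t + s level2 r t])
  /\ (forall (r : Ret) (t : T),
    let dtT := cum_demand r (period_number t) (horizon D) in
    [/\ x level0 r t <= dtT * y plant t,
        x level1 r t <= dtT * y (warehouse_facility (warehouse_of r)) t
      & x level2 r t <= dtT * y (retailer_facility r) t])
  /\ (forall (b : 'I_3) (r : Ret) (t : T), 0 <= x b r t /\ 0 <= s b r t)
  /\ (forall (i : facility) (t : T), y i t = 0 \/ y i t = 1).

End Model.

(* Main.v *)
(* By flow conservation and nonnegative stocks, the amount ordered up to any
   period at level b is at least that at level b' > b, which is at least the
   demand.  Hence ordering at level b up to l_b and at level b' afterwards also
   covers the demand of every initial interval.  Now scan the periods of S^b and
   S^b' in increasing order.  Until the first setup at some k, all orders placed
   in these periods vanish, so the terms before k sum to at least d_{1,k-1}, and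
   the term of k is d_{kl}; without any setup the terms sum to at least d_{1l}. *)
Require Import Defs.
From mathcomp Require Import all_boot all_order all_algebra.
Import Order.TTheory GRing.Theory Num.Theory.
Local Open Scope ring_scope.

Lemma sum_ord_ltS (V : nmodType) (n m : nat) (ltmn : (m < n)%N) (F : 'I_n -> V) :
  \sum_(k < n | (k < m.+1)%N) F k
  = \sum_(k < n | (k < m)%N) F k + F (Ordinal ltmn).
Proof.
rewrite (bigD1 (Ordinal ltmn)) //= addrC; congr (_ + _).
by apply: eq_bigl => k; rewrite ltnS ltn_neqAle andbC.
Qed.

(** Summing the balance equations telescopes the stocks; only the final one survives, because the
    initial stock is zero. *)
Lemma flow_balance (K : realFieldType) (D : lot_sizing_data K)
    (s i o : 'I_(horizon D) -> K) :
  (forall t, previous s t + i t = o t + s t) ->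
  forall t : 'I_(horizon D),
  \sum_(k < horizon D | (k < t.+1)%N) i k = \sum_(k < horizon D | (k < t.+1)%N) o k + s t.
Proof.
move=> bal [m ltmn] /=; elim: m ltmn => [|m IHm] ltmn;
  rewrite !(sum_ord_ltS _ _ _ ltmn); move: (bal (Ordinal ltmn));
  rewrite /previous /=.
  by rewrite !big_pred0 // !add0r.
have -> : ord_pred (Ordinal ltmn) = Ordinal (ltnW ltmn).
  by apply: val_inj; rewrite /= modnDr modn_small // ltnW.
by rewrite (IHm (ltnW ltmn)) -!addrA => ->.
Qed.

Lemma flow_le (K : realFieldType) (D : lot_sizing_data K)
    (s i o : 'I_(horizon D) -> K) (m : nat) :
  (forall t, previous s t + i t = o t + s t) -> (forall t, 0 <= s t) ->
  (m <= horizon D)%N ->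
  \sum_(k < horizon D | (k < m)%N) o k <= \sum_(k < horizon D | (k < m)%N) i k.
Proof.
move=> bal s_ge0; case: m => [|m] ltmn; first by rewrite !big_pred0.
by rewrite (flow_balance _ _ _ _ _ bal (Ordinal ltmn)) lerDl.
Qed.

(** Here [u] and [v] are the orders at the upper and lower level and [e] is the demand. Switching
    from [u] to [v] at [lb] adds to the prefix sum of [v] the sum of [u - v] over the first
    [minn m lb] periods, which is nonnegative. *)
Lemma switch_level_le (K : realFieldType) (n lb m : nat) (e u v : 'I_n -> K) :
  (forall j, (j <= n)%N ->
     \sum_(k < n | (k < j)%N) v k <= \sum_(k < n | (k < j)%N) u k) ->
  (forall j, (j <= n)%N ->
     \sum_(k < n | (k < j)%N) e k <= \sum_(k < n | (k < j)%N) v k) ->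
  (m <= n)%N ->
  \sum_(k < n | (k < m)%N) e k
  <= \sum_(k < n | (k < m)%N) (if (k < lb)%N then u k else v k).
Proof.
move=> le_vu le_ev lemn; apply: le_trans (le_ev _ lemn) _.
have splitE (k : 'I_n) : (if (k < lb)%N then u k else v k)
    = v k + (if (k < lb)%N then u k - v k else 0).
  by case: ifP => _; rewrite ?addr0 // addrC subrK.
rewrite [leRHS](eq_bigr _ (fun k _ => splitE k)).
rewrite big_split lerDl -big_mkcondr /=.
rewrite (eq_bigl (fun k : 'I_n => (k < minn m lb)%N));
  last by move=> k; rewrite leq_min.
by rewrite sumrB subr_ge0; apply: le_vu; rewrite geq_min lemn.
Qed.

Lemma sum_setup_ge (K : realFieldType) (n l : nat) (S : {set 'I_n})
    (e z w c M : 'I_n -> K) :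
  (l <= n)%N ->
  (forall k, 0 <= z k) -> (forall k, 0 <= c k) ->
  (forall k, w k = 0 \/ w k = 1) -> (forall k, z k <= M k * w k) ->
  (forall k : 'I_n, (k < l)%N ->
     c k = \sum_(j < n | (k <= j < l)%N) e j) ->
  (forall m, (m <= n)%N ->
     \sum_(k < n | (k < m)%N) e k <= \sum_(k < n | (k < m)%N) z k) ->
  \sum_(k < n | (k < l)%N) e k
  <= \sum_(k < n | (k < l)%N) (if k \in S then c k * w k else z k).
Proof.
move=> leln z_ge0 c_ge0 w01 le_zw cE le_ez.
set f := fun k => if k \in S then c k * w k else z k.
have f_ge0 k : 0 <= f k.
  by rewrite /f; case: ifP => // _; rewrite mulr_ge0 //; case: (w01 k) => ->.
(* The left case persists while no period of [S] scanned so far has a setup. The right case means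
   that the whole demand is already covered; it persists because [f] is nonnegative. *)
suff /(_ l (leqnn l)) [le_zf | //] : forall m, (m <= l)%N ->
    \sum_(k < n | (k < m)%N) z k <= \sum_(k < n | (k < m)%N) f k
    \/ \sum_(k < n | (k < l)%N) e k <= \sum_(k < n | (k < m)%N) f k.
  exact: le_trans (le_ez _ leln) le_zf.
elim=> [_|m IHm ltml]; first by left; rewrite !big_pred0.
have ltmn := leq_trans ltml leln.
rewrite !(sum_ord_ltS _ _ _ ltmn); set k := Ordinal ltmn.
case: (IHm (ltnW ltml)) => [le_zf | le_ef]; last first.
  by right; apply: le_trans le_ef _; rewrite lerDl.
rewrite {2 4}/f; case: ifP => kS; last by left; rewrite lerD2r.
case: (w01 k) => wk.
  (* Without a setup, [z k] is at most 0, which is the value of [f k]. *)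
  by left; rewrite wk mulr0 lerD // (le_trans (le_zw k)) // wk mulr0.
(* With a setup, [c k] is the demand from [m] on, and the orders before [m] cover the earlier
   demand. *)
right; rewrite wk mulr1 cE // (bigID (fun j : 'I_n => (j < m)%N)) /=.
apply: lerD.
  apply: le_trans le_zf; apply: le_trans (le_ez _ (ltnW ltmn)).
  rewrite (eq_bigl (fun j : 'I_n => (j < m)%N)) // => j.
  case: (ltnP j m) => [ltjm|_]; first by rewrite (ltn_trans ltjm).
  by rewrite andbF.
rewrite (eq_bigl (fun j : 'I_n => (m <= j < l)%N)) // => j.
by rewrite -leqNgt andbC.
Qed.

Lemma sum_periodsE (V : nmodType) (n i j : nat) (F : 'I_n -> V) :
  \sum_(k in periods n i.+1 j) F k = \sum_(k < n | (i <= k < j)%N) F k.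
Proof. by apply: eq_bigl => k; rewrite inE. Qed.

Lemma cum_demand_ge0 (K : realFieldType) (D : lot_sizing_data K)
    (r : retailer D) (i j : nat) : 0 <= cum_demand r i j.
Proof. by apply: sumr_ge0 => k _; apply: demand_ge0. Qed.

Lemma levelP (b : 'I_3) : [\/ b = level0, b = level1 | b = level2].
Proof.
by case: b => [[|[|[|//]]] ltb]; [constructor 1 | constructor 2 | constructor 3];
  apply: val_inj.
Qed.

Section Levels.
Context {K : realFieldType} {D : lot_sizing_data K} {v : point D}.
Hypothesis Xv : X3LF v.

Lemma order_le_setup (b : 'I_3) (r : retailer D) (t : 'I_(horizon D)) :
  px v b r t
  <= cum_demand r (period_number t) (horizon D) * py v (supplier b r) t.
Proof.
case: Xv => _ [/(_ r t) [le0 le1 le2] _].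
by case: (levelP b) => ->.
Qed.

Lemma demand_le_order2 (r : retailer D) (m : nat) :
  (m <= horizon D)%N ->
  \sum_(k < horizon D | (k < m)%N) demand r k
  <= \sum_(k < horizon D | (k < m)%N) px v level2 r k.
Proof.
case: Xv => bal [_ [ge0 _]]; apply: (@flow_le _ _ (ps v level2 r)) => t.
  by case: (bal r t).
by case: (ge0 level2 r t).
Qed.

Lemma order_le_levels (b b' : 'I_3) (r : retailer D) (m : nat) :
  (b <= b')%N -> (m <= horizon D)%N ->
  \sum_(k < horizon D | (k < m)%N) px v b' r k
  <= \sum_(k < horizon D | (k < m)%N) px v b r k.
Proof.
move=> lebb' lemT; case: Xv => bal [_ [ge0 _]].
have le10 : \sum_(k < horizon D | (k < m)%N) px v level1 r k
    <= \sum_(k < horizon D | (k < m)%N) px v level0 r k.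
  apply: (@flow_le _ _ (ps v level0 r)) => // t; first by case: (bal r t).
  by case: (ge0 level0 r t).
have le21 : \sum_(k < horizon D | (k < m)%N) px v level2 r k
    <= \sum_(k < horizon D | (k < m)%N) px v level1 r k.
  apply: (@flow_le _ _ (ps v level1 r)) => // t; first by case: (bal r t).
  by case: (ge0 level1 r t).
(* Only the pair of levels 0 and 2 needs transitivity. *)
by case: (levelP b) (levelP b') lebb' => [] -> [] -> // _; apply: le_trans le10.
Qed.

Lemma demand_le_order (b : 'I_3) (r : retailer D) (m : nat) :
  (m <= horizon D)%N ->
  \sum_(k < horizon D | (k < m)%N) demand r k
  <= \sum_(k < horizon D | (k < m)%N) px v b r k.
Proof.
move=> lemT; apply: le_trans (demand_le_order2 r _ lemT) _.
by apply: order_le_levels => //; rewrite -ltnS.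
Qed.

End Levels.

Lemma sum_split_set (V : nmodType) (I : finType) (L S : {set I}) (F G : I -> V) :
  S \subset L ->
  \sum_(k in L :\: S) F k + \sum_(k in S) G k
  = \sum_(k in L) (if k \in S then G k else F k).
Proof.
move=> subSL; rewrite [RHS](big_setID S) /= (setIidPr subSL) addrC.
congr (_ + _); apply: eq_bigr => k; last by move=> ->.
by rewrite inE => /andP [/negbTE ->].
Qed.

Theorem proposition5 (K : realFieldType) (D : lot_sizing_data K)
    (r : retailer D) (b b' : 'I_3) (l lb : nat)
    (Sb Sb' : {set 'I_(horizon D)}) :
  (b < b')%N ->
  (2 <= l <= horizon D)%N ->
  (1 <= lb < l)%N ->
  let Lb := periods (horizon D) 1 lb in
  let Lb' := periods (horizon D) lb.+1 l in
  Sb \subset Lb ->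
  Sb' \subset Lb' ->
  forall v : point D, X3LF v ->
    \sum_(k in Lb :\: Sb) px v b r k
    + \sum_(k in Sb) cum_demand r (period_number k) l * py v (supplier b r) k
    + \sum_(k in Lb' :\: Sb') px v b' r k
    + \sum_(k in Sb')
        cum_demand r (period_number k) l * py v (supplier b' r) k
    >= cum_demand r 1 l.
Proof.
move=> ltbb' /andP [_ lelT] /andP [_ ltlbl] Lb Lb' subSb subSb' v Xv.
rewrite -addrA !sum_split_set // !sum_periodsE.
(* The two levels are glued into a single one. As the ordinal [k] is the period numbered [k + 1],
   the test [k < lb] selects exactly [Lb]. *)
pose z (k : 'I_(horizon D)) := if (k < lb)%N then px v b r k else px v b' r k.
pose w (k : 'I_(horizon D)) := py v (supplier (if (k < lb)%N then b else b') r) k.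
pose c (k : 'I_(horizon D)) := cum_demand r (period_number k) l.
have [_ [_ [ge0 w01]]] := Xv.
have prefix : \sum_(k < horizon D | (k < l)%N) demand r k
    <= \sum_(k < horizon D | (k < l)%N)
         (if k \in Sb :|: Sb' then c k * w k else z k).
  (* The bound on an order is the demand up to the horizon, whereas the coefficient [c] stops at
     [l]. *)
  apply: (@sum_setup_ge _ _ _ _ _ z w c
    (fun k => cum_demand r (period_number k) (horizon D))) => //.
  - move=> k; rewrite /z; case: ifP => _; first by case: (ge0 b r k).
    by case: (ge0 b' r k).
  - by move=> k; apply: cum_demand_ge0.
  - by move=> k; apply: w01.
  - by move=> k; rewrite /z /w; case: ifP => _; exact: order_le_setup.
  - by move=> k _; rewrite /c /cum_demand sum_periodsE.
  - move=> m lemT; apply: switch_level_le => // j lejT.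
      by apply: order_le_levels => //; apply: ltnW.
    exact: demand_le_order.
rewrite /cum_demand sum_periodsE; apply: le_trans prefix _.
(* Both sides are in fact equal: below [lb] membership in the union means membership in [Sb], and
   from [lb] on membership in [Sb']. *)
rewrite (bigID (fun k : 'I_(horizon D) => (k < lb)%N)) /=.
rewrite le_eqVlt; apply/orP; left; apply/eqP; congr (_ + _).
  apply: eq_big => k.
    by case: (ltnP k lb) => ltklb; rewrite ?andbF // (ltn_trans ltklb).
  case/andP=> _ ltklb; rewrite /c /w /z ltklb inE.
  suff /negbTE-> : k \notin Sb' by rewrite orbF.
  by apply: contraTN ltklb => /(subsetP subSb'); rewrite inE -leqNgt => /andP [].
apply: eq_big => k; first by rewrite -leqNgt andbC.
case/andP=> _ leklb; rewrite /c /w /z (negbTE leklb) inE.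
suff /negbTE-> : k \notin Sb by [].
by apply: contraNN leklb => /(subsetP subSb); rewrite inE => /andP [].
Qed.
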